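(* $$\frac{2\pi}{3^{3/2}}=\frac{3^{4/3}}{2^{4/3}}\prod_{m=0}^{\infty}\frac{(3m+2)^{\frac13}(3m+3)^{\frac13}(3m+3)^{\frac13}(3m+4)^{\frac13}(3m+6)^{\frac23}(3m+6)^{\frac23}}{(3m+4)^{\frac13}(3m+4)^{\frac13}(3m+5)^{\frac13}(3m+5)^{\frac13}(3m+4)^{\frac23}(3m+5)^{\frac23}},$$ that is, $$\frac{2\pi}{3^{\frac{3}{2}}}=\frac{3^{\frac{4}{3}}}{2^{\frac{4}{3}}} \frac{2^{\frac{1}{3}}\cdot3^{\frac{1}{3}}\cdot3^{\frac{1}{3}}\cdot4^{\frac{1}{3}}\cdot6^{\frac{2}{3}}\cdot6^{\frac{2}{3}}}{4^{\frac{1}{3}}\cdot4^{\frac{1}{3}}\cdot5^{\frac{1}{3}}\cdot5^{\frac{1}{3}}\cdot4^{\frac{2}{3}}\cdot5^{\frac{2}{3}}}\cdots .$$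
   Context: The infinite product is the limit of its partial products over $m$. *)

(* Defs.v *)
From Stdlib Require Import Reals.
From Coquelicot Require Import Coquelicot.
Open Scope R_scope.

(* [prod_f_R0 a n] is a 0 * ... * a n, so index n is the partial product with
   n + 1 factors. *)
Definition ex_inf_prod (a : nat -> R) : Prop := ex_finite_lim_seq (prod_f_R0 a).

(* Meaningful only together with [ex_inf_prod a], as [Lim_seq] is total. *)
Definition inf_prod (a : nat -> R) : R := real (Lim_seq (prod_f_R0 a)).

Definition factor (m : nat) : R :=
  let k := 3 * INR m in
  (Rpower (k + 2) (1/3) * Rpower (k + 3) (1/3) * Rpower (k + 3) (1/3) *
   Rpower (k + 4) (1/3) * Rpower (k + 6) (2/3) * Rpower (k + 6) (2/3)) /
  (Rpower (k + 4) (1/3) * Rpower (k + 4) (1/3) * Rpower (k + 5) (1/3) *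
   Rpower (k + 5) (1/3) * Rpower (k + 4) (2/3) * Rpower (k + 5) (2/3)).

(* Main.v *)
Require Import Defs.
From Stdlib Require Import Reals Lra Lia.
From Coquelicot Require Import Coquelicot.
Open Scope R_scope.

(** Each factor splits as a factor of Euler's sine product at one third times a
    telescoping quotient.  With [k = 3 m], comparing cubes gives
    [factor m = w m * (t m / t (m+1))], where
    [w m = (k+3)^2 / ((k+2)(k+4)) = 1 / (1 - ((1/3)/(m+1))^2)] and
    [t m = ((k+2)/(k+3))^(4/3)] ([factor_split]).  The telescoping part tends
    to [t 0 = (2/3)^(4/3)], which cancels the constant in front of the product,
    and the [w m] multiply to [(PI/3) / sin (PI/3) = 2 PI / 3^(3/2)].

    Euler's product ([inverse_sine_product]) comes from the integrals
    [wallis z n] of [cos (2 z t) * (cos t)^(2n)] over [0, PI/2].  They obey a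
    two-term recurrence ([wallis_step]) whose coefficients, divided by those at
    [z = 0], are exactly the factors [1 / (1 - (z/(n+1))^2)]; and
    [wallis z n / wallis 0 n] tends to 1 ([wallis_ratio_lim]), because the mass
    of [(cos t)^(2n)] concentrates at [t = 0]. *)

(** * Wallis-type integrals *)

Definition wallis_fun (z : R) (n : nat) (t : R) : R :=
  cos (2 * z * t) * cos t ^ (2 * n).

Definition wallis (z : R) (n : nat) : R := RInt (wallis_fun z n) 0 (PI / 2).

Lemma continuous_wallis_fun (z : R) (n : nat) (t : R) :
  continuous (wallis_fun z n) t.
Proof.
  apply (ex_derive_continuous (wallis_fun z n)).
  unfold wallis_fun; auto_derive; exact I.
Qed.

Lemma ex_RInt_wallis_fun (z : R) (n : nat) :
  ex_RInt (wallis_fun z n) 0 (PI / 2).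
Proof.
  apply (@ex_RInt_continuous R_CompleteNormedModule).
  intros t _; apply continuous_wallis_fun.
Qed.

Lemma is_RInt_wallis (z : R) (n : nat) :
  is_RInt (wallis_fun z n) 0 (PI / 2) (wallis z n).
Proof. exact (RInt_correct _ _ _ (ex_RInt_wallis_fun z n)). Qed.

(** With [f = cos (2 z t)] and [g = (cos t)^N], [N = 2n+2], the Wronskian
    [f g' - f' g] vanishes at both ends and has derivative [f g'' - f'' g],
    which is [N (N-1) f (cos t)^(N-2) - (N^2 - 4 z^2) f g]. *)
Lemma wallis_step (z : R) (n : nat) :
  ((INR n + 1) ^ 2 - z ^ 2) * wallis z (S n) =
  (INR n + 1) * (INR n + 1 / 2) * wallis z n.
Proof.
  set (N := 2 * (INR n + 1)).
  set (F := fun t => - N * cos (2 * z * t) * cos t ^ (2 * n + 1) * sin t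
                     + 2 * z * sin (2 * z * t) * cos t ^ (2 * n + 2)).
  set (dF := fun t => minus (scal (N * (N - 1)) (wallis_fun z n t))
                            (scal (N ^ 2 - 4 * z ^ 2) (wallis_fun z (S n) t))).
  assert (HF : is_RInt dF 0 (PI / 2) (minus (F (PI / 2)) (F 0))).
  { apply (is_RInt_derive F dF).
    - intros t _. unfold F, dF, wallis_fun.
      auto_derive; [exact I|].
      unfold minus, plus, opp, scal; simpl; unfold mult; simpl.
      replace (n + (n + 0))%nat with (2 * n)%nat by lia.
      replace (n + S (n + 0))%nat with (2 * n + 1)%nat by lia.
      replace (Init.Nat.pred (2 * n + 1)) with (2 * n)%nat by lia.
      replace (Init.Nat.pred (2 * n + 2)) with (2 * n + 1)%nat by lia.
      rewrite !plus_INR, !mult_INR, !pow_add; simpl.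
      assert (Hs : sin t * sin t = 1 - cos t * cos t).
      { generalize (sin2_cos2 t); unfold Rsqr; lra. }
      unfold N.
      ring [Hs].
    - intros t _. apply (continuous_minus (V := R_NormedModule)).
      + apply (continuous_scal_r (V := R_NormedModule)), continuous_wallis_fun.
      + apply (continuous_scal_r (V := R_NormedModule)), continuous_wallis_fun. }
  assert (HI : is_RInt dF 0 (PI / 2)
     (minus (scal (N * (N - 1)) (wallis z n))
            (scal (N ^ 2 - 4 * z ^ 2) (wallis z (S n))))).
  { apply (is_RInt_minus (V := R_NormedModule));
      apply (is_RInt_scal (V := R_NormedModule)), is_RInt_wallis. }
  assert (E := eq_trans (eq_sym (is_RInt_unique _ _ _ _ HF))
                        (is_RInt_unique _ _ _ _ HI)).
  unfold F in E.
  unfold minus, plus, opp, scal in E; simpl in E; unfold mult in E; simpl in E.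
  rewrite cos_PI2, Rmult_0_r, sin_0 in E.
  rewrite !pow_i in E by lia.
  unfold N in E; simpl in E. lra.
Qed.

Lemma wallis_le (y z : R) (n m : nat) :
  (forall t, 0 < t < PI / 2 -> wallis_fun y n t <= wallis_fun z m t) ->
  wallis y n <= wallis z m.
Proof.
  intros H. apply RInt_le; auto using ex_RInt_wallis_fun.
  generalize PI_RGT_0; lra.
Qed.

Lemma wallis_0_0 : wallis 0 0 = PI / 2.
Proof.
  unfold wallis.
  rewrite (RInt_ext _ (fun _ => 1)).
  - rewrite RInt_const. unfold scal; simpl; unfold mult; simpl; ring.
  - intros t _; unfold wallis_fun.
    rewrite Rmult_0_r, Rmult_0_l, cos_0; simpl; ring.
Qed.

Lemma wallis_z_0 (z : R) : z <> 0 -> wallis z 0 = sin (PI * z) / (2 * z).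
Proof.
  intros Hz. apply is_RInt_unique.
  replace (sin (PI * z) / (2 * z)) with
    (minus (sin (2 * z * (PI / 2)) / (2 * z)) (sin (2 * z * 0) / (2 * z))).
  - apply (is_RInt_derive (fun t => sin (2 * z * t) / (2 * z))).
    + intros t _. unfold wallis_fun. auto_derive; [exact I|]. simpl; field; lra.
    + intros t _. apply continuous_wallis_fun.
  - unfold minus, plus, opp; simpl.
    rewrite Rmult_0_r, sin_0. replace (2 * z * (PI / 2)) with (PI * z) by field.
    field; lra.
Qed.

Lemma wallis_0_S (n : nat) :
  wallis 0 (S n) = (INR n + 1 / 2) / (INR n + 1) * wallis 0 n.
Proof.
  generalize (wallis_step 0 n) (pos_INR n); intros E Hn.
  apply (Rmult_eq_reg_l ((INR n + 1) ^ 2)); [|nra].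
  replace ((INR n + 1) ^ 2) with ((INR n + 1) ^ 2 - 0 ^ 2) at 1 by ring.
  rewrite E. field. lra.
Qed.

Lemma wallis_0_pos (n : nat) : 0 < wallis 0 n.
Proof.
  induction n as [|n IH].
  - rewrite wallis_0_0. generalize PI_RGT_0; lra.
  - rewrite wallis_0_S. generalize (pos_INR n); intros Hn.
    apply Rmult_lt_0_compat; [apply Rdiv_lt_0_compat; lra|exact IH].
Qed.

(** For [0 <= t <= PI/2] and [0 <= z <= 1], [1 - cos (2 z t) = 2 (sin (z t))^2 <= 2 (sin t)^2], so
    [wallis 0 n - wallis z n] is at most
    [2 (wallis 0 n - wallis 0 (n+1)) = wallis 0 n / (n+1)]. *)
Lemma wallis_ratio_bounds (z : R) (n : nat) :
  0 <= z <= 1 -> 1 - / (INR n + 1) <= wallis z n / wallis 0 n <= 1.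
Proof.
  intros Hz.
  assert (Hpos := wallis_0_pos n). assert (Hn := pos_INR n).
  assert (Hc : forall t, 0 <= cos t ^ (2 * n)).
  { intros t; rewrite pow_mult; apply pow_le, pow2_ge_0. }
  assert (Hup : wallis z n <= wallis 0 n).
  { apply wallis_le; intros t _; unfold wallis_fun.
    rewrite Rmult_0_r, Rmult_0_l, cos_0.
    apply Rmult_le_compat_r; [apply Hc|apply COS_bound]. }
  assert (Hlow : 2 * wallis 0 (S n) - wallis 0 n <= wallis z n).
  { assert (HI : is_RInt (fun t => minus (scal 2 (wallis_fun 0 (S n) t))
                                         (wallis_fun 0 n t)) 0 (PI / 2)
                   (minus (scal 2 (wallis 0 (S n))) (wallis 0 n))).
    { apply (is_RInt_minus (V := R_NormedModule)); [|apply is_RInt_wallis].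
      apply (is_RInt_scal (V := R_NormedModule)), is_RInt_wallis. }
    refine (is_RInt_le _ _ _ _ _ _ _ HI (is_RInt_wallis z n) _).
    - generalize PI_RGT_0; lra.
    - intros t Ht.
      unfold minus, plus, opp, scal; simpl; unfold mult; simpl.
      unfold wallis_fun.
      replace (2 * S n)%nat with (2 + 2 * n)%nat by lia.
      rewrite pow_add, Rmult_0_r, Rmult_0_l, cos_0.
      replace (2 * z * t) with (2 * (z * t)) by ring.
      rewrite cos_2a_sin.
      assert (Hzt : 0 <= z * t <= t) by nra.
      assert (H0 : 0 <= sin (z * t)) by (apply sin_ge_0; lra).
      assert (H1 : sin (z * t) <= sin t) by (apply sin_incr_1; lra).
      assert (H2 : cos t ^ 2 = 1 - sin t ^ 2).
      { generalize (sin2_cos2 t); unfold Rsqr; simpl; lra. }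
      rewrite H2. specialize (Hc t).
      assert (H3 : sin (z * t) ^ 2 <= sin t ^ 2) by (apply pow_incr; lra).
      nra. }
  rewrite wallis_0_S in Hlow.
  split.
  - apply Rle_div_r; [exact Hpos|].
    replace ((1 - / (INR n + 1)) * wallis 0 n) with
      (2 * ((INR n + 1 / 2) / (INR n + 1) * wallis 0 n) - wallis 0 n)
      by (field; lra).
    exact Hlow.
  - apply Rle_div_l; [exact Hpos|]. lra.
Qed.

Lemma wallis_ratio_lim (z : R) :
  0 <= z <= 1 -> is_lim_seq (fun n => wallis z n / wallis 0 n) 1.
Proof.
  intros Hz.
  apply is_lim_seq_le_le with (fun n => 1 - / (INR n + 1)) (fun _ => 1).
  - intros n. apply wallis_ratio_bounds; exact Hz.
  - replace (Finite 1) with (Finite (1 - 0)) by (f_equal; ring).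
    apply is_lim_seq_minus'; [apply is_lim_seq_const|].
    apply (is_lim_seq_ext (fun n => / INR (S n))).
    + intros n; rewrite S_INR; reflexivity.
    + apply (is_lim_seq_incr_1 (fun n => / INR n)).
      apply (is_lim_seq_inv _ p_infty); [apply is_lim_seq_INR|discriminate].
  - apply is_lim_seq_const.
Qed.

(** * The sine product *)

Definition inverse_sine_factor (z : R) (m : nat) : R :=
  / (1 - (z / (INR m + 1)) ^ 2).

Lemma wallis_ratio_S (z : R) (n : nat) :
  0 < z < 1 ->
  wallis z (S n) / wallis 0 (S n) =
  wallis z n / wallis 0 n * inverse_sine_factor z n.
Proof.
  intros Hz. assert (Hn := pos_INR n). assert (Hpos := wallis_0_pos n).
  assert (E := wallis_step z n).
  assert (Hd : 0 < (INR n + 1) ^ 2 - z ^ 2) by nra.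
  replace (wallis z (S n)) with
    ((INR n + 1) * (INR n + 1 / 2) * wallis z n / ((INR n + 1) ^ 2 - z ^ 2))
    by (rewrite <- E; field; lra).
  rewrite wallis_0_S. unfold inverse_sine_factor. field.
  repeat split; lra.
Qed.

Lemma inverse_sine_partial_product (z : R) (n : nat) :
  0 < z < 1 ->
  prod_f_R0 (inverse_sine_factor z) n * (sin (PI * z) / (PI * z)) =
  wallis z (S n) / wallis 0 (S n).
Proof.
  intros Hz. assert (HP := PI_RGT_0).
  induction n as [|n IH].
  - rewrite wallis_ratio_S by exact Hz.
    rewrite wallis_0_0, wallis_z_0 by lra. simpl. field. lra.
  - rewrite wallis_ratio_S, <- IH by exact Hz. simpl. ring.
Qed.

Lemma inverse_sine_product (z : R) :
  0 < z < 1 ->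
  is_lim_seq (prod_f_R0 (inverse_sine_factor z)) (PI * z / sin (PI * z)).
Proof.
  intros Hz. assert (HP := PI_RGT_0).
  assert (Hs : 0 < sin (PI * z)) by (apply sin_gt_0; nra).
  apply (is_lim_seq_ext
    (fun n => wallis z (S n) / wallis 0 (S n) * (PI * z / sin (PI * z)))).
  - intros n. rewrite <- inverse_sine_partial_product by exact Hz.
    field. repeat split; lra.
  - replace (Finite (PI * z / sin (PI * z)))
      with (Finite (1 * (PI * z / sin (PI * z)))) by (f_equal; ring).
    apply is_lim_seq_mult'; [|apply is_lim_seq_const].
    apply (is_lim_seq_incr_1 (fun n => wallis z n / wallis 0 n)).
    apply wallis_ratio_lim; lra.
Qed.

(** * Splitting off a telescoping product *)

Definition tele (m : nat) : R :=
  Rpower ((3 * INR m + 2) / (3 * INR m + 3)) (4 / 3).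

Lemma tele_pos (m : nat) : 0 < tele m.
Proof. apply exp_pos. Qed.

Lemma div_exp (x y : R) : exp x / exp y = exp (x - y).
Proof. unfold Rdiv, Rminus. rewrite exp_plus, exp_Ropp. reflexivity. Qed.

(** All terms are real powers of [k+2], ..., [k+6], so the identity is one between
    linear combinations of their logarithms. *)
Lemma factor_split (m : nat) :
  factor m = inverse_sine_factor (1 / 3) m * (tele m / tele (S m)).
Proof.
  assert (Hm := pos_INR m).
  unfold factor, tele. rewrite S_INR. set (k := 3 * INR m).
  assert (Hk : 0 <= k) by (unfold k; lra).
  replace (3 * (INR m + 1) + 2) with (k + 5) by (unfold k; ring).
  replace (3 * (INR m + 1) + 3) with (k + 6) by (unfold k; ring).
  replace (inverse_sine_factor (1 / 3) m)
    with ((k + 3) * (k + 3) / ((k + 2) * (k + 4))).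
  2: { unfold inverse_sine_factor, k. field. repeat split; nra. }
  unfold Rpower. rewrite !ln_div by lra.
  replace ((k + 3) * (k + 3) / ((k + 2) * (k + 4))) with
    (exp (ln (k + 3)) * exp (ln (k + 3)) /
     (exp (ln (k + 2)) * exp (ln (k + 4)))) by (rewrite !exp_ln; lra).
  rewrite <- !exp_plus, !div_exp, <- exp_plus. f_equal. field.
Qed.

Lemma factor_partial_product (n : nat) :
  prod_f_R0 factor n =
  prod_f_R0 (inverse_sine_factor (1 / 3)) n * (tele 0 / tele (S n)).
Proof.
  induction n as [|n IH].
  - apply factor_split.
  - change (prod_f_R0 factor (S n)) with (prod_f_R0 factor n * factor (S n)).
    change (prod_f_R0 (inverse_sine_factor (1 / 3)) (S n)) with
      (prod_f_R0 (inverse_sine_factor (1 / 3)) n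
       * inverse_sine_factor (1 / 3) (S n)).
    rewrite IH, factor_split.
    generalize (tele_pos (S n)) (tele_pos (S (S n))); intros H1 H2.
    field. lra.
Qed.

Lemma tele_lim : is_lim_seq tele 1.
Proof.
  assert (E : Rpower 1 (4 / 3) = 1).
  { unfold Rpower. rewrite ln_1, Rmult_0_r. apply exp_0. }
  rewrite <- E.
  apply (is_lim_seq_continuous (fun x => Rpower x (4 / 3))
           (fun m => (3 * INR m + 2) / (3 * INR m + 3))).
  - apply derivable_continuous_pt. eexists. apply derivable_pt_lim_power. lra.
  - apply (is_lim_seq_ext (fun m => 1 - / 3 * / INR (S m))).
    + intros m. rewrite S_INR. assert (Hm := pos_INR m). field. lra.
    + replace (Finite 1) with (Finite (1 - / 3 * 0)) by (f_equal; ring).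
      apply is_lim_seq_minus'; [apply is_lim_seq_const|].
      apply is_lim_seq_mult'; [apply is_lim_seq_const|].
      apply (is_lim_seq_incr_1 (fun n => / INR n)).
      apply (is_lim_seq_inv _ p_infty); [apply is_lim_seq_INR|discriminate].
Qed.

Lemma factor_product_lim :
  is_lim_seq (prod_f_R0 factor)
    (PI * (1 / 3) / sin (PI * (1 / 3)) * tele 0).
Proof.
  apply (is_lim_seq_ext (fun n =>
    prod_f_R0 (inverse_sine_factor (1 / 3)) n * (tele 0 / tele (S n)))).
  - intros n; symmetry; apply factor_partial_product.
  - apply is_lim_seq_mult'; [apply inverse_sine_product; lra|].
    replace (Finite (tele 0)) with (Finite (tele 0 / 1)) by (f_equal; field).
    apply is_lim_seq_div'; [apply is_lim_seq_const| |lra].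
    apply (is_lim_seq_incr_1 tele), tele_lim.
Qed.

Theorem mainTheorem6 :
  ex_inf_prod factor /\
  2 * PI / Rpower 3 (3/2) =
    Rpower 3 (4/3) / Rpower 2 (4/3) * inf_prod factor.
Proof.
  split; [eexists; exact factor_product_lim|].
  unfold inf_prod. rewrite (is_lim_seq_unique _ _ factor_product_lim). simpl.
  replace (PI * (1 / 3)) with (PI / 3) by field.
  rewrite sin_PI3.
  replace (3 / 2) with (1 + / 2) by field.
  rewrite Rpower_plus, Rpower_1, Rpower_sqrt by lra.
  assert (Ht : tele 0 = Rpower 2 (4 / 3) / Rpower 3 (4 / 3)).
  { unfold tele. simpl INR.
    replace ((3 * 0 + 2) / (3 * 0 + 3)) with (2 / 3) by field.
    unfold Rpower. rewrite ln_div by lra.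
    rewrite div_exp. f_equal. field. }
  rewrite Ht.
  assert (Hs : 0 < sqrt 3) by (apply sqrt_lt_R0; lra).
  assert (H2 : 0 < Rpower 2 (4 / 3)) by apply exp_pos.
  assert (H3 : 0 < Rpower 3 (4 / 3)) by apply exp_pos.
  field. lra.
Qed.
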